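(* Consider the 1D first-order Lax–Friedrichs scheme $$\bar{\mathbf U}_j^{n+1}=\bar{\mathbf U}_j^n-\frac{\Delta t_n}{\Delta x}\Big(\hat{\mathbf F}_1(\bar{\mathbf U}_j^n,\bar{\mathbf U}_{j+1}^n)-\hat{\mathbf F}_1(\bar{\mathbf U}_{j-1}^n,\bar{\mathbf U}_j^n)\Big)$$ with the standard numerical viscosity parameter $\alpha_{1,n}^{LF}=\max_j\mathscr R_1(\bar{\mathbf U}_j^n)$ and time step $\Delta t_n=C\,\Delta x/\alpha_{1,n}^{LF}$, where $C$ is the CFL number, applied to discrete initial data satisfying $\bar{\mathbf U}_j^0\in\mathcal G$ and $\bar B_{1,j}^0=B_{const}$ for all $j$ (with $B_{const}$ a constant independent of $j$). For any constant $C>0$ the scheme is not positivity-preserving; that is, for every $C>0$ there exist an adiabatic index $\gamma>1$ of an ideal gas, a constant $B_{const}$ and such initial data for which the numerical solution does not always stay in $\mathcal G$ (some $\bar{\mathbf U}_j^{n}\notin\mathcal G$).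
   Context: A state is $\mathbf U=(\rho,\mathbf m,\mathbf B,E)^\top\in\mathbb R^8$ with $\rho,E\in\mathbb R$, $\mathbf m,\mathbf B\in\mathbb R^3$. For $\rho>0$ put $\mathbf v=\mathbf m/\rho$, $\mathcal E(\mathbf U)=E-\frac12\big(\frac{|\mathbf m|^2}{\rho}+|\mathbf B|^2\big)$, $e=\mathcal E(\mathbf U)/\rho$, $p=(\gamma-1)\rho e$ (ideal equation of state), $p_{tot}=p+\frac{|\mathbf B|^2}{2}$. Admissible states: $\mathcal G=\{\mathbf U:\rho>0,\ \mathcal E(\mathbf U)>0\}$. Flux: $$\mathbf F_1(\mathbf U)=\big(\rho v_1,\ \rho v_1\mathbf v-B_1\mathbf B+p_{tot}\mathbf e_1,\ v_1\mathbf B-B_1\mathbf v,\ v_1(E+p_{tot})-B_1(\mathbf v\cdot\mathbf B)\big)^\top,\quad \mathbf e_1=(1,0,0).$$ LF flux: $\hat{\mathbf F}_1(\mathbf U^-,\mathbf U^+)=\frac12\big(\mathbf F_1(\mathbf U^-)+\mathbf F_1(\mathbf U^+)-\alpha_{1,n}^{LF}(\mathbf U^+-\mathbf U^-)\big)$. Spectral radius: $\mathscr R_1(\mathbf U)=|v_1|+\mathcal C_1$ with $$\mathcal C_1=\frac1{\sqrt2}\Big[\mathcal C_s^2+\frac{|\mathbf B|^2}{\rho}+\sqrt{\Big(\mathcal C_s^2+\frac{|\mathbf B|^2}{\rho}\Big)^2-4\frac{\mathcal C_s^2B_1^2}{\rho}}\Big]^{1/2},\qquad \mathcal C_s=\sqrt{\gamma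 p/\rho}.$$ The mesh is a uniform 1D mesh with cell index $j\in\mathbb Z$ and spacing $\Delta x>0$; $\bar B_{1,j}^n$ is the first magnetic component of $\bar{\mathbf U}_j^n$. A scheme is called positivity-preserving if, given admissible discrete initial data (here with constant $B_1$), its numerical solutions $\bar{\mathbf U}_j^n$ always stay in $\mathcal G$. *)

(* Defs.v *)
From HB Require Import structures.
From mathcomp Require Import all_boot all_order all_algebra.
From mathcomp Require Import reals.

Set Implicit Arguments.
Unset Strict Implicit.
Unset Printing Implicit Defensive.

Import Order.TTheory GRing.Theory Num.Theory.

Local Open Scope ring_scope.

(* (rho, m, B, E) in R^8, as an iterated product so that the componentwise
   vector-space operations of the scheme are the library's product ones. *)
Definition state (R : realType) : lmodType R :=
  (R^o * 'rV[R]_3 * 'rV[R]_3 * R^o)%type.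

Definition mkstate (R : realType) (rho : R) (m B : 'rV[R]_3) (E : R) : state R :=
  (rho, m, B, E).

Section IdealMHD.
Variable R : realType.
Implicit Types (U : state R) (u w : 'rV[R]_3) (gamma : R).

Definition dens U : R := U.1.1.1.
Definition mom U : 'rV[R]_3 := U.1.1.2.
Definition mag U : 'rV[R]_3 := U.1.2.
Definition ener U : R := U.2.

Definition dot u w : R := \sum_(i < 3) u 0 i * w 0 i.
Definition norm2 u : R := dot u u.

(* Index 0 is the x-direction, written 1 on paper. *)
Definition e1 : 'rV[R]_3 := delta_mx 0 0.
Definition vel U : 'rV[R]_3 := (dens U)^-1 *: mom U.
Definition v1 U : R := vel U 0 0.
Definition B1 U : R := mag U 0 0.

Definition rho_e U : R :=
  ener U - 2^-1 * (norm2 (mom U) / dens U + norm2 (mag U)).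
Definition spec_int_energy U : R := rho_e U / dens U.
Definition pressure gamma U : R := (gamma - 1) * dens U * spec_int_energy U.
Definition ptot gamma U : R := pressure gamma U + norm2 (mag U) / 2.

Definition admissible U : Prop := 0 < dens U /\ 0 < rho_e U.

Definition F1 gamma U : state R :=
  mkstate (dens U * v1 U)
          ((dens U * v1 U) *: vel U - B1 U *: mag U + ptot gamma U *: e1)
          (v1 U *: mag U - B1 U *: vel U)
          (v1 U * (ener U + ptot gamma U) - B1 U * dot (vel U) (mag U)).

Definition sound_speed gamma U : R :=
  Num.sqrt (gamma * pressure gamma U / dens U).

(* The fast magnetosonic speed in the x-direction. *)
Definition fast_speed gamma U : R :=
  let a := sound_speed gamma U ^+ 2 + norm2 (mag U) / dens U in
  (Num.sqrt 2)^-1 *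
  Num.sqrt (a + Num.sqrt (a ^+ 2 -
    4 * (sound_speed gamma U ^+ 2 * B1 U ^+ 2 / dens U))).

Definition spectral_radius gamma U : R := `|v1 U| + fast_speed gamma U.

Definition LF_flux gamma (alpha : R) (Um Up : state R) : state R :=
  2^-1 *: (F1 gamma Um + F1 gamma Up - alpha *: (Up - Um)).

(* A maximum that is attained: on the infinite mesh it need not exist. *)
Definition is_max (f : int -> R) (a : R) : Prop :=
  (exists j, f j = a) /\ (forall j, f j <= a).

Definition LF_step gamma (C dx : R) (V W : int -> state R) : Prop :=
  exists alpha dt : R,
    [/\ is_max (fun j => spectral_radius gamma (V j)) alpha,
        dt = C * dx / alpha &
        forall j : int,
          W j = V j - (dt / dx) *: (LF_flux gamma alpha (V j) (V (j + 1))
                                    - LF_flux gamma alpha (V (j - 1)) (V j))].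

(* U is the numerical solution up to time level N. Only finitely many levels
   are demanded since the scheme is physically meaningless, and may break
   down, once a state has left the admissible set. *)
Definition LF_solution gamma (C dx : R) (U0 : int -> state R) (N : nat)
    (U : nat -> int -> state R) : Prop :=
  (forall j, U 0%N j = U0 j) /\
  (forall n, (n < N)%N -> LF_step gamma C dx (U n) (U n.+1)).

Definition admissible_data (Bconst : R) (U0 : int -> state R) : Prop :=
  forall j, admissible (U0 j) /\ B1 (U0 j) = Bconst.

End IdealMHD.

(* Main.v *)
From HB Require Import structures.
Require Import Defs.
From mathcomp Require Import all_boot all_order all_algebra.
From mathcomp Require Import reals.
From mathcomp Require Import ring lra.
Import Order.TTheory GRing.Theory Num.Theory.
Local Open Scope ring_scope.

(** For a fixed velocity [u] and field [w], the quantity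
      rho_e U + rho |v - u|^2 / 2 + |B - w|^2 / 2,
    the energy of [U] relative to [u] and [w], is an affine function of [U]
    ([energy_in_frameE]), and it is positive on admissible states
    ([admissible_energy_gt0]).  A state at which one of these affine functions
    is not positive is therefore not admissible.  Because the function is
    affine, its value after one step of the scheme is the sum of the
    contributions of the states and of their fluxes.

    The data are a Riemann problem [UL | UR] with velocity along x and
    magnetic field along y (so Bconst = 0), and gamma = 2.  Take [u] and [w] to
    be the velocity and the field of [UL]; then the relative energy of [UL] is
    only its internal energy, which is equal to its pressure [q].  In the cell
    just left of the jump, a step with viscosity alpha gives
      UL + C/2 (UR - UL) - C/(2 alpha) (F1 UR - F1 UL).
    The spectral radius bounds the wave speeds inside each state, but it does
    not see the jump of B, and the flux term can remove more relative energy
    than the viscosity supplies.  With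
      UL : rho = 20,    v = 1/2, B = 2, p = q,
      UR : rho = 26/25, v = 0,   B = 1, p = 1/50,
    the spectral radius of [UR] is exactly 1 and that of [UL] is at most 1 when
    q <= 1/2, so alpha = 1.  For q = 0 the viscosity supplies 13/20 and the
    flux removes 37/50, in units of C/2.  For general [q] the new relative
    energy is (1 - C/4) q - 9C/200, which is negative as soon as q <= C/25.
    As [q] may be as small as needed, every C > 0 is reached, in one step. *)

(** * The relative energy as a positive affine functional *)

Section RelativeEnergy.
Set Implicit Arguments.
Unset Strict Implicit.
Variable R : realType.
Implicit Types (U : state R) (u w : 'rV[R]_3).

(** The linear part of the energy relative to [u] and [w]; the constant
    [norm2 w / 2] is left out so that this commutes with the linear
    combinations of states and fluxes in the scheme. *)
Definition energy_in_frame u w U : R :=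
  dens U * norm2 u / 2 - dot u (mom U) - dot w (mag U) + ener U.

Lemma dotE u w : dot u w = u 0 0 * w 0 0 + u 0 1 * w 0 1 + u 0 2%:R * w 0 2%:R.
Proof.
rewrite /dot !big_ord_recl big_ord0 addr0 addrA.
by congr (_ + _ * _ + _ * _); congr (_ _ _); apply/val_inj.
Qed.

Lemma norm2_ge0 u : 0 <= norm2 u.
Proof. by apply: sumr_ge0 => i _; rewrite -expr2 sqr_ge0. Qed.

Lemma energy_in_frame_is_linear u w : linear_for *%R (energy_in_frame u w).
Proof.
move=> a U V; rewrite /energy_in_frame /norm2 !dotE.
rewrite /dens /mom /mag /ener /= !mxE /GRing.scale /=.
by ring.
Qed.

HB.instance Definition _ u w :=
  GRing.isLinear.Build R (state R) R *%R (energy_in_frame u w)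
    (energy_in_frame_is_linear u w).

(** Completing the squares in [vel U] and [mag U]. *)
Lemma energy_in_frameE u w U : dens U != 0 ->
  energy_in_frame u w U + norm2 w / 2 =
  rho_e U + dens U * norm2 (vel U - u) / 2 + norm2 (mag U - w) / 2.
Proof.
move=> rho0; rewrite /energy_in_frame /rho_e /vel /norm2 !dotE !mxE.
by field.
Qed.

Lemma admissible_energy_gt0 u w U :
  admissible U -> 0 < energy_in_frame u w U + norm2 w / 2.
Proof.
move=> [rho_gt0 e_gt0]; rewrite energy_in_frameE ?gt_eqF//.
have := norm2_ge0 (mag U - w).
have := mulr_ge0 (ltW rho_gt0) (norm2_ge0 (vel U - u)).
by lra.
Qed.

End RelativeEnergy.

(** * Flow along x with a transverse magnetic field *)

Section TransverseState.
Set Implicit Arguments.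
Unset Strict Implicit.
Variable R : realType.
Implicit Types r v b p gamma : R.

Definition vec_xy (x y : R) : 'rV[R]_3 := \row_i [:: x; y; 0]`_i.

(** Parametrized by the pressure [p] instead of the energy, since the flux and
    the wave speeds depend on the pressure. *)
Definition transverse r v b p gamma : state R :=
  mkstate r (vec_xy (r * v) 0) (vec_xy 0 b)
    (r * v ^+ 2 / 2 + b ^+ 2 / 2 + p / (gamma - 1)).

Lemma dot_vec_xy (x y z t : R) : dot (vec_xy x y) (vec_xy z t) = x * z + y * t.
Proof. by rewrite dotE !mxE /= mulr0 addr0. Qed.

Lemma B1_transverse r v b p gamma : B1 (transverse r v b p gamma) = 0.
Proof. by rewrite /B1 mxE. Qed.

Lemma rho_e_transverse r v b p gamma : r != 0 ->
  rho_e (transverse r v b p gamma) = p / (gamma - 1).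
Proof.
move=> r0; rewrite /rho_e /norm2 /= !dot_vec_xy /dens /=.
by set e := p / _; field.
Qed.

Lemma admissible_transverse r v b p gamma : 0 < r -> 0 < p -> 1 < gamma ->
  admissible (transverse r v b p gamma).
Proof.
by move=> r0 p0 g1; split=> //; rewrite rho_e_transverse ?gt_eqF// divr_gt0 ?subr_gt0.
Qed.

Lemma vel_transverse r v b p gamma : r != 0 ->
  vel (transverse r v b p gamma) = vec_xy v 0.
Proof.
move=> r0; apply/rowP => i; rewrite !mxE /dens /=.
by case: i => [[|[|[|//]]]] ? /=; rewrite ?mulr0 ?mulKf.
Qed.

Lemma v1_transverse r v b p gamma : r != 0 -> v1 (transverse r v b p gamma) = v.
Proof. by move=> r0; rewrite /v1 vel_transverse// mxE. Qed.

Lemma pressure_transverse r v b p gamma : r != 0 -> gamma != 1 ->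
  pressure gamma (transverse r v b p gamma) = p.
Proof.
move=> r0 g1; rewrite /pressure /spec_int_energy rho_e_transverse// /dens /=.
by field; rewrite r0 subr_eq0.
Qed.

(** Since B1 = 0, the inner square root of the fast speed is that of a perfect
    square, and the slow wave degenerates. *)
Lemma spectral_radius_transverse r v b p gamma : 0 < r -> 0 <= p -> 1 < gamma ->
  spectral_radius gamma (transverse r v b p gamma) =
  `|v| + Num.sqrt ((gamma * p + b ^+ 2) / r).
Proof.
move=> r0 p0 g1; rewrite /spectral_radius v1_transverse ?gt_eqF//.
congr (_ + _).
rewrite /fast_speed /sound_speed pressure_transverse ?gt_eqF// B1_transverse.
rewrite /dens /norm2 dot_vec_xy /=.
have gp0 : 0 <= gamma * p / r.
  by rewrite divr_ge0 ?mulr_ge0 ?(ltW r0)// ltW// (lt_trans ltr01).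
rewrite sqr_sqrtr// mulr0 add0r -expr2 -mulrDl expr0n /= mulr0 mul0r mulr0 subr0.
have a0 : 0 <= (gamma * p + b ^+ 2) / r.
  by rewrite mulrDl addr_ge0// divr_ge0 ?sqr_ge0 ?ltW.
have dbl (x : R) : x + x = 2 * x by ring.
rewrite sqrtr_sqr ger0_norm// dbl sqrtrM// mulKf//.
by rewrite gt_eqF// sqrtr_gt0.
Qed.

Lemma F1_transverse r v b p gamma : r != 0 -> gamma != 1 ->
  F1 gamma (transverse r v b p gamma) =
  mkstate (r * v) (vec_xy (r * v ^+ 2 + p + b ^+ 2 / 2) 0) (vec_xy 0 (v * b))
    (v * (r * v ^+ 2 / 2 + b ^+ 2 + p / (gamma - 1) + p)).
Proof.
move=> r0 g1; rewrite /F1 /ptot pressure_transverse// v1_transverse//.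
rewrite vel_transverse// B1_transverse.
rewrite /norm2 /dens /ener /= !dot_vec_xy /mkstate.
congr (_, _, _, _); last by set e := p / _; field.
- by apply/rowP => i; rewrite !mxE; case: i => [[|[|[|//]]]] ? /=; ring.
- by apply/rowP => i; rewrite !mxE; case: i => [[|[|[|//]]]] ? /=; ring.
Qed.

Lemma energy_in_frame_vec_xy (u w r m b E : R) :
  energy_in_frame (vec_xy u 0) (vec_xy 0 w)
    (mkstate r (vec_xy m 0) (vec_xy 0 b) E) =
  r * u ^+ 2 / 2 - u * m - w * b + E.
Proof.
rewrite /energy_in_frame /norm2 /mom /mag /= !dot_vec_xy /dens /ener /=.
by ring.
Qed.

End TransverseState.

(** * The Riemann problem that leaves the admissible set *)

Theorem theorem3p1 (R : realType) (C dx : R) (hC : 0 < C) (hdx : 0 < dx) :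
  exists (gamma Bconst : R) (U0 : int -> state R),
    [/\ 1 < gamma,
        admissible_data Bconst U0 &
        exists (N : nat) (U : nat -> int -> state R),
          LF_solution gamma C dx U0 N U /\
          exists j : int, ~ admissible (U N j)].
Proof.
(* The first bound keeps the spectral radius of [UL] at most 1; the second one
   makes the relative energy after the step negative. *)
have [q [q_gt0 q_le q_leC]] : exists q : R, [/\ 0 < q, q <= 2^-1 & q <= C / 25].
  exists (Num.min (2^-1) (C / 25)).
  by rewrite lt_min invr_gt0 ltr0n divr_gt0// !ge_min !lexx orbT.
pose UL : state R := transverse 20 2^-1 2 q 2.
pose UR : state R := transverse (26 / 25) 0 1 50^-1 2.
pose U0 (j : int) := if 0 < j then UR else UL.
have one_lt2 : (1 : R) < 2 by lra.
have radR : spectral_radius 2 UR = 1.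
  rewrite spectral_radius_transverse//; try lra.
  by rewrite normr0 add0r -[RHS]sqrtr1; congr Num.sqrt; field.
have radL : spectral_radius 2 UL <= 1.
  rewrite spectral_radius_transverse//; try lra.
  have : Num.sqrt ((2 * q + 2 ^+ 2) / 20) <= Num.sqrt (2^-1 ^+ 2 : R).
    by apply: ler_wsqrtr; lra.
  by rewrite sqrtr_sqr !ger0_norm; lra.
pose W (j : int) := U0 j - C *: (LF_flux 2 1 (U0 j) (U0 (j + 1))
                                 - LF_flux 2 1 (U0 (j - 1)) (U0 j)).
exists 2, 0, U0; split=> //.
  move=> j; rewrite /U0; case: ifP => _; rewrite B1_transverse; split=> //;
    by apply: admissible_transverse; lra.
exists 1%N, (fun n => if n is 0 then U0 else W); split.
  split=> // -[|//] _; exists 1, (C * dx); split.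
  - split; first by exists 1.
    by move=> j; rewrite /U0; case: ifP => _; rewrite ?radR.
  - by rewrite divr1.
  - by move=> j; rewrite mulfK ?gt_eqF.
(* Cell 0 is the last one that contains [UL]; the frame is that of [UL]. *)
exists 0 => /(admissible_energy_gt0 (vec_xy 2^-1 0) (vec_xy 0 2)).
apply/negP; rewrite -leNgt /W /U0 /LF_flux /=.
rewrite !(linearB, linearD, linearZ) /= !F1_transverse; try lra.
rewrite /norm2 dot_vec_xy !energy_in_frame_vec_xy.
have -> : (2 : R) - 1 = 1 by ring.
rewrite !divr1.
have Cq_gt0 : 0 < C * q by rewrite mulr_gt0.
rewrite [X in X <= _](_ : _ = (1 - C / 4) * q - 9 / 200 * C); last by field.
by lra.
Qed.
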